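(* Let $m,n,n_f$ be positive integers, $C\in\mathbb{R}^{m\times n}$, and $\sigma_-,\sigma_+\in\mathbb{R}$ with $\sigma_-<0<\sigma_+$. For $i=1,\dots,n_f$ let $\hat F_i\subset\mathbb{R}^m$ be the parallelotope of perturbed loads of the $i$-th load case (defined in the context), let $S_i=\{f_i^{(j)} : 1\le j\le n_i\}$ be the finite set of its vertices, so that $\hat F_i=\operatorname{conv} S_i$, and let $\hat F=\bigcup_{i=1}^{n_f}\hat F_i$. Define $$M_1:=\Big\{ s\in\mathbb{R}^n : \forall \hat f\in\hat F\ \exists\, w(\hat f)\in\mathbb{R}^n \text{ such that } C\,w(\hat f)=\hat f \text{ and } \sigma_- s\le w(\hat f)\le \sigma_+ s\Big\}$$ and $$M_2:=\Big\{ s\in\mathbb{R}^n : \forall f_j\in\bigcup_{i=1}^{n_f}S_i\ \exists\, w_j\in\mathbb{R}^n \text{ such that } C\,w_j=f_j \text{ and } \sigma_- s\le w_j\le \sigma_+ s\Big\}.$$ Then $M_1=M_2$.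
   Context: Inequalities between vectors are understood componentwise. $\operatorname{conv}$ denotes the convex hull. Setting (truss topology optimization with multiple load cases): $C\in\mathbb{R}^{m\times n}$ is the reduced geometry matrix of a truss with $n$ potential bars in $\mathbb{R}^d$, $d\in\{2,3\}$; $s\in\mathbb{R}^n$ is the vector of bar cross sections, $w\in\mathbb{R}^n$ the vector of inner bar forces, and $\sigma_-<0<\sigma_+$ are stress limits equal for all bars. The coordinates of the load space $\mathbb{R}^m$ correspond to pairs (node $j$, spatial direction $k$), distinct pairs corresponding to distinct coordinates. Given nominal loads $f_1,\dots,f_{n_f}\in\mathbb{R}^m$, let $J_i$ be the finite set of nodes at which $f_i$ acts. For $j\in J_i$ and $1\le k\le d$, let $r(j,k)\in\mathbb{R}^m$ be the vector with entry $1$ in the component belonging to node $j$ and spatial direction $k$, and $0$ elsewhere. Given reals $\Delta_-(i,j,k)\le\Delta_+(i,j,k)$, the set of perturbed loads of the $i$-th load case is $$\hat F_i:=\Big\{ f_i+\sum_{j\in J_i}\sum_{k=1}^{d} r(j,k)\,\delta_{i,j,k} \;:\; \Delta_-(i,j,k)\le\delta_{i,j,k}\le\Delta_+(i,j,k) \text{ for all } j\in J_i,\ 1\le k\le d\Big\}.$$ It is assumed that $\{f_1,\dots,f_{n_f}\}\subset\hat F=\bigcup_{i=1}^{n_f}\hat F_i$. The points $f_i^{(1)},\dots,f_i^{(n_i)}$ are the vertices (extreme points) of the parallelotope $\hat F_i$. *)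

(* Defs.v *)
From HB Require Import structures.
From mathcomp Require Import all_boot all_order all_algebra.
From mathcomp Require Import boolp classical_sets reals.

Set Implicit Arguments.
Unset Strict Implicit.
Unset Printing Implicit Defensive.

Import Order.TTheory GRing.Theory Num.Theory.
Local Open Scope classical_set_scope.
Local Open Scope ring_scope.

(* x is extreme in A when it is not in the interior of a nondegenerate segment
   of A. For a polytope these are exactly the vertices. *)
Definition extreme_points (R : realType) (E : lmodType R) (A : set E) : set E :=
  [set x | A x /\
    forall (y z : E) (t : R), A y -> A z -> 0 < t < 1 ->
      x = t *: y + (1 - t) *: z -> y = x /\ z = x].

(* V is the type of nodes, and coord (j, k) the coordinate of the load space
   R^m belonging to node j and spatial direction k. *)
Section PerturbedLoads.
Variables (R : realType) (m d : nat) (V : finType) (coord : V * 'I_d -> 'I_m).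

(* The set J_i: the nodes at which the load f has a nonzero component. *)
Definition loaded_nodes (f : 'cV[R]_m) : {set V} :=
  [set j | [exists k : 'I_d, f (coord (j, k)) 0 != 0]].

Definition unit_load (j : V) (k : 'I_d) : 'cV[R]_m :=
  delta_mx (coord (j, k)) 0.

(* The set \hat F_i for f = f_i. Only the values of Dminus, Dplus and delta at
   the loaded nodes matter. *)
Definition perturbed_loads (f : 'cV[R]_m) (Dminus Dplus : V -> 'I_d -> R) :
    set 'cV[R]_m :=
  [set fhat | exists delta : V -> 'I_d -> R,
     (forall j k, j \in loaded_nodes f ->
        Dminus j k <= delta j k <= Dplus j k) /\
     fhat = f + \sum_(j in loaded_nodes f) \sum_(k < d)
                  delta j k *: unit_load j k].

End PerturbedLoads.

(* The set of all s such that every load in L is in equilibrium with some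
   vector w of bar forces satisfying sminus s <= w <= splus s. With L = \hat F
   it is M_1, with L the union of the vertex sets S_i it is M_2. *)
Definition feasible_sections (R : realType) (m n : nat) (C : 'M[R]_(m, n))
    (sminus splus : R) (L : set 'cV[R]_m) : set 'cV[R]_n :=
  [set s | forall f, L f -> exists w : 'cV[R]_n,
     C *m w = f /\ forall l, sminus * s l 0 <= w l 0 <= splus * s l 0].

(* Main.v *)
Require Import Defs.
From HB Require Import structures.
From mathcomp Require Import all_boot all_order all_algebra.
From mathcomp Require Import boolp classical_sets reals.
From mathcomp Require Import ring lra.

Set Implicit Arguments.
Unset Strict Implicit.
Unset Printing Implicit Defensive.

Import Order.TTheory GRing.Theory Num.Theory.
Local Open Scope classical_set_scope.
Local Open Scope ring_scope.

(** The loads that a given vector s of cross sections can carry form a convex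
    set, because the equilibrium equation and the stress bounds are linear in
    the pair of load and bar forces ([carried_load_convex]).  It therefore
    suffices that a convex set containing the vertices of a parallelotope
    contains all of it.

    Distinct pairs (node, direction) have distinct coordinates, so every set of
    perturbed loads is an axis-parallel box of R^m, degenerate in the
    coordinates that are not perturbed ([perturbed_loads_box]).  A point of a
    box all of whose coordinates are at a bound is extreme
    ([box_corner_extreme]).  Any other point has a coordinate strictly between its bounds and is a convex
    combination of the two points obtained by moving that coordinate to either
    bound; each of these has fewer coordinates off the bounds, so induction on
    their number brings the point down to corners ([box_sub_convex]). *)

(** * Boxes and their corners *)

Definition box (R : realType) (m : nat) (lo hi : 'cV[R]_m) : set 'cV[R]_m :=
  [set x | forall r, lo r 0 <= x r 0 <= hi r 0].

Definition box_corner (R : realType) (m : nat) (lo hi x : 'cV[R]_m) : Prop :=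
  forall r, (x r 0 == lo r 0) || (x r 0 == hi r 0).

Definition segment_closed (R : realType) (E : lmodType R) (K : set E) : Prop :=
  forall (y z : E) (t : R), K y -> K z -> 0 < t < 1 ->
    K (t *: y + (1 - t) *: z).

(** A bound is an extreme value of its interval, and this can be applied in
    each coordinate separately. *)
Lemma box_corner_extreme (R : realType) (m : nat) (lo hi x : 'cV[R]_m) :
  box lo hi x -> box_corner lo hi x -> extreme_points (box lo hi) x.
Proof.
move=> bx cx; split=> // y z t yb zb /andP[t0 t1] exyz.
suff eq r : y r 0 = x r 0 /\ z r 0 = x r 0.
  by split; apply/colP=> r; have [] := eq r.
have := congr1 (fun u : 'cV[R]_m => u r 0) exyz; rewrite !mxE => e.
have /andP[y1 y2] := yb r; have /andP[z1 z2] := zb r.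
by case/orP: (cx r) => /eqP ex; rewrite ex in e *; split; nra.
Qed.

Definition set_coord (R : realType) (m : nat) (x : 'cV[R]_m) (r : 'I_m)
    (a : R) : 'cV[R]_m :=
  \col_i (if i == r then a else x i 0).

Definition off_bounds (R : realType) (m : nat) (lo hi x : 'cV[R]_m) :
    {set 'I_m} :=
  [set r | (x r 0 != lo r 0) && (x r 0 != hi r 0)].

Lemma box_set_coord (R : realType) (m : nat) (lo hi x : 'cV[R]_m) r a :
  box lo hi x -> lo r 0 <= a <= hi r 0 -> box lo hi (set_coord x r a).
Proof. by move=> bx ha i; rewrite mxE; case: eqP => [->|_]. Qed.

Lemma off_bounds_set_coord (R : realType) (m : nat) (lo hi x : 'cV[R]_m) r a :
  r \in off_bounds lo hi x -> (a == lo r 0) || (a == hi r 0) ->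
  (#|off_bounds lo hi (set_coord x r a)| < #|off_bounds lo hi x|)%N.
Proof.
move=> rx ha; apply: proper_card; apply/properP; split.
  apply/fintype.subsetP=> i; rewrite !inE mxE; have [->|//] := eqVneq i r.
  by case/orP: ha => ->; rewrite ?andbF.
by exists r => //; rewrite !inE mxE eqxx -negb_or ha.
Qed.

(** This plays the role of writing a box as the convex hull of its corners.
    The induction is on the number of coordinates off their bounds, and each
    step splits the point along one such coordinate. *)
Lemma box_sub_convex (R : realType) (m : nat) (lo hi : 'cV[R]_m)
    (K : set 'cV[R]_m) :
  segment_closed K ->
  (forall x, box lo hi x -> box_corner lo hi x -> K x) ->
  box lo hi `<=` K.
Proof.
move=> convK cornerK x.
have [k] := ubnP #|off_bounds lo hi x|; elim: k x => // k IH x ltk bx.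
have [off0|[r rx]] := set_0Vmem (off_bounds lo hi x).
  apply: cornerK => // r; apply: contraT => /norP[n1 n2].
  by have := finset.in_set0 r; rewrite -off0 inE n1 n2.
have /andP[lx xh] := bx r; have := rx; rewrite inE => /andP[nl nh].
have {nl}lx : lo r 0 < x r 0 by rewrite lt_def nl.
have {nh}xh : x r 0 < hi r 0 by rewrite lt_def eq_sym nh.
have lh := lt_trans lx xh.
have shorter a : (a == lo r 0) || (a == hi r 0) -> K (set_coord x r a).
  move=> ha; apply: IH.
    exact: leq_trans (off_bounds_set_coord rx ha) _.
  by apply: box_set_coord => //; case/orP: ha => /eqP ->; rewrite lexx ltW.
(* The weight that makes coordinate r of the combination equal to x r 0. *)
pose t := (hi r 0 - x r 0) / (hi r 0 - lo r 0).
have t01 : 0 < t < 1.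
  by rewrite divr_gt0 ?subr_gt0 // ltr_pdivrMr ?subr_gt0 // mul1r ltrD2l ltrN2.
have -> : x = t *: set_coord x r (lo r 0) + (1 - t) *: set_coord x r (hi r 0).
  apply/colP=> i; rewrite !mxE; case: eqP => [->|_]; last by ring.
  by rewrite /t; field; rewrite subr_eq0 gt_eqF.
by apply: convK => //; apply: shorter; rewrite eqxx ?orbT.
Qed.

(** * Perturbed loads form a box *)

Definition perturb (R : realType) (m d : nat) (V : finType)
    (coord : V * 'I_d -> 'I_m) (f : 'cV[R]_m) (delta : V -> 'I_d -> R) :
    'cV[R]_m :=
  f + \sum_(j in loaded_nodes coord f) \sum_(k < d)
        delta j k *: unit_load R coord j k.

Lemma perturbE (R : realType) (m d : nat) (V : finType)
    (coord : V * 'I_d -> 'I_m) (f : 'cV[R]_m) delta r :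
  perturb coord f delta r 0 =
  f r 0 + \sum_(j in loaded_nodes coord f) \sum_(k < d)
            delta j k * (r == coord (j, k))%:R.
Proof.
rewrite mxE summxE; congr (_ + _); apply: eq_bigr => j _.
by rewrite summxE; apply: eq_bigr => k _; rewrite !mxE andbT.
Qed.

(** Entries of [perturb] are monotone in the perturbation, which puts the
    perturbed loads into the box.  Conversely, the displacement of a point of
    the box is a perturbation that reaches it: at a coordinate that is not
    perturbed both bounds equal the nominal load, and at a perturbed one the
    injectivity of [coord] leaves a single term of the sum. *)
Lemma perturbed_loads_box (R : realType) (m d : nat) (V : finType)
    (coord : V * 'I_d -> 'I_m) (f : 'cV[R]_m) (Dminus Dplus : V -> 'I_d -> R) :
  injective coord ->
  perturbed_loads coord f Dminus Dplus =
  box (perturb coord f Dminus) (perturb coord f Dplus).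
Proof.
move=> coordI.
have at_loaded delta j k : j \in loaded_nodes coord f ->
    perturb coord f delta (coord (j, k)) 0 =
    f (coord (j, k)) 0 + delta j k.
  move=> jJ; rewrite perturbE (bigD1 j) //= (bigD1 k) //= eqxx mulr1.
  rewrite !big1 ?addr0 // => [j' /andP[_ nj]|k' nk].
    apply: big1 => k' _; rewrite (inj_eq coordI) xpair_eqE.
    by rewrite eq_sym (negPf nj) mulr0.
  by rewrite (inj_eq coordI) xpair_eqE eqxx /= eq_sym (negPf nk) mulr0.
have elsewhere delta r :
    (forall j k, j \in loaded_nodes coord f -> r != coord (j, k)) ->
    perturb coord f delta r 0 = f r 0.
  move=> nr; rewrite perturbE big1 ?addr0 // => j jJ.
  by apply: big1 => k _; rewrite (negPf (nr j k jJ)) mulr0.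
apply/seteqP; split=> x /=.
  case=> delta [hdelta ->] r; rewrite -/(perturb coord f delta) !perturbE.
  rewrite !lerD2l; apply/andP; split; apply: ler_sum => j jJ;
    apply: ler_sum => k _; apply: ler_wpM2r => //;
    by case/andP: (hdelta j k jJ).
move=> bx; pose delta j k := x (coord (j, k)) 0 - f (coord (j, k)) 0.
exists delta; split=> [j k jJ|].
  by have := bx (coord (j, k)); rewrite !at_loaded // /delta lerBrDl lerBlDl.
apply/colP=> r; rewrite -/(perturb coord f delta).
have [/existsP[j /andP[jJ /existsP[k /eqP ->]]]|/existsPn nr] :=
  boolP [exists j, (j \in loaded_nodes coord f) &&
                   [exists k, r == coord (j, k)]].
  by rewrite at_loaded // /delta addrC subrK.
have nr' j k : j \in loaded_nodes coord f -> r != coord (j, k).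
  by move=> jJ; have := nr j; rewrite jJ /= => /existsPn.
have := bx r; rewrite !elsewhere // => h.
by apply/eqP; rewrite eq_sym eq_le.
Qed.

(** * Loads carried by given cross sections *)

Definition carried_load (R : realType) (m n : nat) (C : 'M[R]_(m, n))
    (sminus splus : R) (s : 'cV[R]_n) : set 'cV[R]_m :=
  [set f | exists w : 'cV[R]_n,
     C *m w = f /\ forall l, sminus * s l 0 <= w l 0 <= splus * s l 0].

(** Combining the bar forces with the same weights as the loads preserves
    equilibrium and the stress bounds. *)
Lemma carried_load_convex (R : realType) (m n : nat) (C : 'M[R]_(m, n))
    (sminus splus : R) (s : 'cV[R]_n) :
  segment_closed (carried_load C sminus splus s).
Proof.
move=> y z t [v [<- hv]] [w [<- hw]] /andP[t0 t1].
exists (t *: v + (1 - t) *: w); split=> [|l].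
  by rewrite mulmxDr !scalemxAr.
have /andP[v1 v2] := hv l; have /andP[w1 w2] := hw l.
by rewrite !mxE; apply/andP; split; nra.
Qed.

Theorem theorem1 (R : realType) (m n nf d : nat)
    (hm : (0 < m)%N) (hn : (0 < n)%N) (hnf : (0 < nf)%N)
    (hd : d = 2%N \/ d = 3%N)
    (C : 'M[R]_(m, n)) (sminus splus : R) (hsigma : sminus < 0 < splus)
    (V : finType) (coord : V * 'I_d -> 'I_m) (hcoord : injective coord)
    (f : 'I_nf -> 'cV[R]_m) (Dminus Dplus : 'I_nf -> V -> 'I_d -> R)
    (hD : forall i j k, j \in loaded_nodes coord (f i) ->
            Dminus i j k <= Dplus i j k) :
  let hatFi := fun i : 'I_nf =>
    perturbed_loads coord (f i) (Dminus i) (Dplus i) in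
  let S := fun i : 'I_nf => extreme_points (hatFi i) in
  let hatF := \bigcup_(i in [set: 'I_nf]) hatFi i in
  range f `<=` hatF ->
  let M1 := feasible_sections C sminus splus hatF in
  let M2 := feasible_sections C sminus splus
              (\bigcup_(i in [set: 'I_nf]) S i) in
  M1 = M2.
Proof.
move=> hatFi S hatF _ M1 M2.
have hatFiE i : hatFi i = box (perturb coord (f i) (Dminus i))
                              (perturb coord (f i) (Dplus i)).
  exact: perturbed_loads_box.
apply/seteqP; split=> s hs g [i _ gi].
  by apply: hs; exists i => //; case: gi.
rewrite hatFiE in gi.
apply: (box_sub_convex (@carried_load_convex _ _ _ C sminus splus s) _ gi).
move=> x bx cx; apply: hs; exists i => //.
by rewrite /S hatFiE; apply: box_corner_extreme.
Qed.
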